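(* Let $\phi:[0,1]\to[0,1]$ be a Lipschitz continuous map (with Lipschitz constant $L_\phi$), and let $\mathcal{K}$ be the associated Koopman operator, $\mathcal{K}f=f\circ\phi$. Then, for any $f\in C([0,1])$, an upper bound on the error in approximating $\mathcal{K}f$ by $\mathcal{B}_n\mathcal{K}f$ is given by $$\|\mathcal{B}_n\mathcal{K}f-\mathcal{K}f\|_\infty\leq \frac{3}{2}\,\omega_{f}\left(\frac{L_{\phi}}{\sqrt{n}}\right)\bigg|_{\left[\phi(0),\phi(1)\right]}.$$
   Context: $C([0,1])$ is the space of continuous functions on $[0,1]$, equipped with the supremum norm $\|f\|_\infty=\sup_{x\in[0,1]}|f(x)|$. For $n\in\mathbb{N}$, the Bernstein operator $\mathcal{B}_n:C([0,1])\to C([0,1])$ maps $f$ to the $n$th Bernstein polynomial $\mathcal{B}_n(f;x)=\sum_{k=0}^n f(k/n)\,b_{n,k}(x)$, where $b_{n,k}(x)=\binom{n}{k}x^k(1-x)^{n-k}$. A Lipschitz constant of $\phi$ is a constant $L_\phi$ such that $|\phi(x)-\phi(y)|\le L_\phi|x-y|$ for all $x,y\in[0,1]$. The modulus of continuity of $f$ is $\omega_f(\delta)=\sup\{|f(y)-f(x)|: |y-x|\le\delta,\ x,y\in[0,1]\}$, where $\delta$ is a positive number. The notation $\omega_f(\delta)|_{[\phi(0),\phi(1)]}$ denotes the modulus of continuity of $f$ evaluated over $[\phi(0),\phi(1)]\subseteq[0,1]$, i.e. with $x,y$ restricted to $[\phi(0),\phi(1)]$.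
   Formalization: The printed bound fails when φ leaves [φ(0),φ(1)] (n=1, f(x)=x, φ(x)=x(1−x)); proved here for n≥1 with the modulus over the range φ([0,1]) for every Lipschitz φ, and over [φ(0),φ(1)] itself when φ takes its values there. *)

(* Defs.v *)
From mathcomp Require Import all_boot all_order all_algebra.
From mathcomp Require Import all_classical all_reals all_analysis.
Import Order.TTheory GRing.Theory Num.Theory.
Import numFieldNormedType.Exports.

Set Implicit Arguments.
Unset Strict Implicit.
Unset Printing Implicit Defensive.

Local Open Scope classical_set_scope.
Local Open Scope ring_scope.

(* Elements of C([0,1]) are represented by functions f : R -> R satisfying
   {within `[0, 1], continuous f}; their values outside [0,1] are never used
   by the definitions below when phi maps [0,1] to itself. *)

Definition bernstein_basis (R : realType) (n k : nat) (x : R) : R :=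
  'C(n, k)%:R * x ^+ k * (1 - x) ^+ (n - k).

(* Meaningful for 0 < n: at n = 0 the node k / n is the junk value 0 / 0 = 0. *)
Definition bernstein (R : realType) (n : nat) (f : R -> R) (x : R) : R :=
  \sum_(k < n.+1) f (k%:R / n%:R) * bernstein_basis n k x.

Definition koopman (R : realType) (phi f : R -> R) : R -> R := f \o phi.

(* sup is total: it returns 0 on unbounded or empty sets. The set is nonempty
   here, and bounded as soon as f is continuous on [0,1]. *)
Definition sup_norm01 (R : realType) (f : R -> R) : R :=
  sup [set `|f x| | x in `[0, 1]].

(* Modulus of continuity of f with both points restricted to D. The set of
   values is bounded when f is continuous on [0,1] and D is included in [0,1];
   if D is nonempty and 0 <= delta it contains 0. *)
Definition modulus_of_continuity (R : realType) (f : R -> R) (D : set R)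
    (delta : R) : R :=
  sup [set `|f p.2 - f p.1| |
         p in [set p : R * R | [/\ D p.1, D p.2 & `|p.2 - p.1| <= delta]]].

(* Main.v *)
(* |f(u) - f(v)| <= (1 + lam) omega(d) whenever u, v lie in a convex set and
   |u - v| <= lam d. With d = L / sqrt n and lam = sqrt n |k/n - x| this bounds
   |f(phi(k/n)) - f(phi(x))|; averaging over the binomial weights, whose mean
   absolute deviation is at most 1 / (2 sqrt n), gives the factor 1 + 1/2. *)
Require Import Defs.
From mathcomp Require Import all_boot all_order all_algebra.
From mathcomp Require Import all_classical all_reals all_analysis.
From mathcomp Require Import ring lra.
Import Order.TTheory GRing.Theory Num.Theory.
Import numFieldNormedType.Exports.

Local Open Scope classical_set_scope.
Local Open Scope ring_scope.

Lemma bernstein_basis_ge0 (R : realType) (n k : nat) (x : R) :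
  0 <= x <= 1 -> 0 <= bernstein_basis n k x.
Proof.
move=> /andP[x0 x1]; rewrite /bernstein_basis.
by rewrite !mulr_ge0 ?exprn_ge0 ?subr_ge0.
Qed.

(* Conditioning a binomial variable on its first trial (Pascal's rule). *)
Lemma sum_bernstein_basisS (R : realType) (h : nat -> R) (n : nat) (x : R) :
  \sum_(k < n.+2) h k * bernstein_basis n.+1 k x =
  (1 - x) * (\sum_(k < n.+1) h k * bernstein_basis n k x) +
  x * (\sum_(k < n.+1) h k.+1 * bernstein_basis n k x).
Proof.
rewrite !big_distrr/= big_ord_recl/= [X in _ = X + _]big_ord_recl.
rewrite [X in _ = _ + X]big_ord_recr [X in _ + X = _]big_ord_recr/=.
(* The terms [k = 0] and [k = n + 1] come from one side only and are split off; Pascal's rule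
   handles the others. *)
have -> : \sum_(i < n) h (bump 0 i) * bernstein_basis n.+1 (bump 0 i) x =
    \sum_(i < n) (1 - x) * (h (bump 0 i) * bernstein_basis n (bump 0 i) x) +
    \sum_(i < n) x * (h i.+1 * bernstein_basis n i x).
  rewrite -big_split/=; apply: eq_bigr => i _.
  rewrite /bernstein_basis /bump/= add1n binS natrD subSS !exprS.
  by rewrite -(subnSK (ltn_ord i)) exprS; ring.
by rewrite /bernstein_basis /bump/= !add1n !bin0 !binn !subnn !subn0 !exprS; ring.
Qed.

Lemma sum_bernstein_basis (R : realType) (n : nat) (x : R) :
  \sum_(k < n.+1) bernstein_basis n k x = 1.
Proof.
under eq_bigr do rewrite -[bernstein_basis _ _ _]mul1r.
elim: n => [|n IHn]; first by rewrite big_ord1 /bernstein_basis bin0 !expr0 !mulr1.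
by rewrite (sum_bernstein_basisS _ (fun=> 1))/= !IHn mulr1 mulr1 subrK.
Qed.

(** Variance plus squared bias. The centre [c] is arbitrary because conditioning on a success moves
    it to [c - 1] in the induction. *)
Lemma sum_sqr_bernstein_basis (R : realType) (n : nat) (x c : R) :
  \sum_(k < n.+1) (k%:R - c) ^+ 2 * bernstein_basis n k x =
  n%:R * x * (1 - x) + (n%:R * x - c) ^+ 2.
Proof.
elim: n c => [|n IHn] c.
  by rewrite big_ord1 /bernstein_basis bin0 subnn !expr0 /=; ring.
rewrite (sum_bernstein_basisS _ (fun k => (k%:R - c) ^+ 2)) IHn.
have shift (k : nat) : (k.+1%:R - c) ^+ 2 = (k%:R - (c - 1)) ^+ 2 :> R.
  by rewrite -natr1; ring.
under eq_bigr do rewrite shift.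
by rewrite IHn -natr1; ring.
Qed.

(** A quadratic bound on the deviation reduces this to the variance [x * (1 - x) / n] of [k / n],
    which is at most [1 / (4 n)]. *)
Lemma sum_norm_bernstein_basis (R : realType) (n : nat) (x : R) :
  (0 < n)%N -> 0 <= x <= 1 ->
  \sum_(k < n.+1) `|k%:R / n%:R - x| * bernstein_basis n k x
    <= (2 * Num.sqrt n%:R)^-1.
Proof.
move=> n_gt0 x01.
set s := Num.sqrt n%:R; have s_gt0 : 0 < s by rewrite sqrtr_gt0 ltr0n.
have sn : n%:R = s ^+ 2 by rewrite sqr_sqrtr.
(* AM-GM in the form [t <= s t^2 + (4 s)^-1], with [t = |k/n - x|]. *)
apply: (@le_trans _ _ (\sum_(k < n.+1)
  (s ^- 3 * ((k%:R - n%:R * x) ^+ 2 * bernstein_basis n k x) +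
   (4 * s)^-1 * bernstein_basis n k x))).
  apply: ler_sum => k _; rewrite [s ^- 3 * _]mulrA -mulrDl.
  apply: ler_wpM2r; first exact: bernstein_basis_ge0.
  rewrite -subr_ge0.
  have -> : s ^- 3 * (k%:R - n%:R * x) ^+ 2 = s * `|k%:R / n%:R - x| ^+ 2.
    by rewrite real_normK ?num_real// sn; field; rewrite gt_eqF.
  set t := `| _ |.
  have -> : s * t ^+ 2 + (4 * s)^-1 - t = s * (t - (2 * s)^-1) ^+ 2.
    by field; rewrite gt_eqF.
  by rewrite mulr_ge0 ?sqr_ge0// ltW.
rewrite big_split/= -!big_distrr/= sum_sqr_bernstein_basis sum_bernstein_basis.
rewrite subrr expr0n addr0 mulr1 sn -subr_ge0.
(* The slack is a square since [1 / 4 - x * (1 - x) = (x - 1 / 2) ^ 2]. *)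
have -> : (2 * s)^-1 - (s ^- 3 * (s ^+ 2 * x * (1 - x)) + (4 * s)^-1) =
    (x - 2^-1) ^+ 2 / s.
  by field; rewrite gt_eqF.
by rewrite divr_ge0 ?sqr_ge0// ltW.
Qed.

Lemma bernstein_error_le (R : realType) (g : R -> R) (n : nat) (w : R) :
  (0 < n)%N -> 0 <= w ->
  (forall x y : R, 0 <= x <= 1 -> 0 <= y <= 1 ->
    `|g y - g x| <= (1 + Num.sqrt n%:R * `|y - x|) * w) ->
  sup_norm01 (bernstein n g \- g) <= 3 / 2 * w.
Proof.
move=> n_gt0 w_ge0 gw; apply: ge_sup.
  by exists `|(bernstein n g \- g) 0|; exists 0 => //=; rewrite in_itv/= lexx ler01.
move=> _ [x /= + <-]; rewrite in_itv/= => x01.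
pose s : R := Num.sqrt n%:R; have s_gt0 : 0 < s by rewrite sqrtr_gt0 ltr0n.
(* The weights sum to 1, so the error at [x] is the mean of [g (k / n) - g x]. *)
have -> : bernstein n g x - g x =
    \sum_(k < n.+1) (g (k%:R / n%:R) - g x) * bernstein_basis n k x.
  under [RHS]eq_bigr do rewrite mulrBl.
  by rewrite sumrB -big_distrr/= sum_bernstein_basis mulr1.
apply: (le_trans (ler_norm_sum _ _ _)).
apply: (@le_trans _ _ (\sum_(k < n.+1) (w * bernstein_basis n k x +
    w * s * (`|k%:R / n%:R - x| * bernstein_basis n k x)))).
  apply: ler_sum => k _.
  rewrite normrM (ger0_norm (bernstein_basis_ge0 _ _ _ _ x01)) [w * s * _]mulrA -mulrDl.
  apply: ler_wpM2r; first exact: bernstein_basis_ge0.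
  have -> (t : R) : w + w * s * t = (1 + s * t) * w by ring.
  apply: gw => //; rewrite divr_ge0 ?ler0n//= ler_pdivrMr ?ltr0n// mul1r ler_nat.
  by rewrite -ltnS.
rewrite big_split/= -!big_distrr/= sum_bernstein_basis.
have /(ler_wpM2l (mulr_ge0 w_ge0 (ltW s_gt0))) :=
  sum_norm_bernstein_basis _ _ _ n_gt0 x01.
rewrite -/s; have -> : w * s * (2 * s)^-1 = w / 2 by field; rewrite gt_eqF.
lra.
Qed.

(** Boundedness of [f] on [D] makes the supremum a true upper bound rather than the default value
    0. *)
Lemma norm_sub_le_modulus (R : realType) (f : R -> R) (D : set R) (d u v : R) :
  (exists M, forall x, D x -> `|f x| <= M) -> D u -> D v -> `|v - u| <= d ->
  `|f v - f u| <= modulus_of_continuity f D d.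
Proof.
move=> [M fM] Du Dv uvd; apply: ub_le_sup; last by exists (u, v).
exists (M + M) => _ [[a b] /= [Da Db _] <-].
by rewrite (le_trans (ler_normB _ _))// lerD ?fM.
Qed.

(* The segment from u to v is cut into floor(lam) + 1 steps of length at most
   d, which stay in D by convexity. *)
Lemma norm_sub_le_mul_modulus (R : realType) (f : R -> R) (D : set R)
    (d lam u v : R) :
  is_interval D -> (exists M, forall x, D x -> `|f x| <= M) -> 0 <= d ->
  0 <= lam -> D u -> D v -> `|v - u| <= lam * d ->
  `|f v - f u| <= (1 + lam) * modulus_of_continuity f D d.
Proof.
move=> Ditv fM d_ge0 lam_ge0 Du Dv uv; set w := modulus_of_continuity f D d.
have w_ge0 : 0 <= w.
  apply: (le_trans (normr_ge0 (f u - f u))).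
  by apply: norm_sub_le_modulus; rewrite // subrr normr0.
(* [N <= 1 + lam] yields the factor in the bound; [lam < N] makes each step at most [d] long. *)
pose N := (Num.truncn lam).+1.
have /andP[N_le lam_lt] := truncn_itv lam_ge0.
have N_gt0 : 0 < N%:R :> R by rewrite ltr0n.
pose p (i : nat) := u + i%:R / N%:R * (v - u).
have Dp i : (i <= N)%N -> D (p i).
  move=> iN; have i0 : 0 <= i%:R / N%:R :> R by rewrite divr_ge0.
  have i1 : i%:R / N%:R <= 1 :> R by rewrite ler_pdivrMr// mul1r ler_nat.
  have [uv'|/ltW vu] := leP u v.
    by apply: (Ditv u v) => //; rewrite /p; apply/andP; split; nra.
  by apply: (Ditv v u) => //; rewrite /p; apply/andP; split; nra.
have -> : f v - f u = \sum_(0 <= i < N) (f (p i.+1) - f (p i)).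
  rewrite (telescope_sumr (f \o p))//= /p mul0r mul0r addr0 divff ?gt_eqF//.
  by rewrite mul1r [u + _]addrC subrK.
rewrite big_mkord; apply: (le_trans (ler_norm_sum _ _ _)).
apply: (@le_trans _ _ (\sum_(i < N) w)); last first.
  rewrite sumr_const card_ord -mulr_natl; apply: ler_wpM2r => //.
  by rewrite /N -natr1 addrC lerD2l.
apply: ler_sum => i _; apply: norm_sub_le_modulus => //; try exact: Dp.
  by apply: Dp; exact: ltnW.
have -> : p i.+1 - p i = (v - u) / N%:R by rewrite /p -natr1; field; rewrite gt_eqF.
rewrite normrM normfV (ger0_norm (ltW N_gt0)) ler_pdivrMr//.
by rewrite (le_trans uv)// mulrC ler_wpM2l// ltW.
Qed.

(** Keeping [D] abstract lets one proof serve both the range of [phi] and the literal interval. *)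
Lemma bernstein_koopman_error_le (R : realType) (phi f : R -> R) (L : R)
    (D : set R) (n : nat) :
  set_fun `[0, 1] D phi -> is_interval D -> D `<=` `[0, 1] ->
  L.-lipschitz_(`[0, 1]) phi -> {within `[0, 1], continuous f} -> (0 < n)%N ->
  sup_norm01 (bernstein n (koopman phi f) \- koopman phi f)
    <= 3 / 2 * modulus_of_continuity f D (L / Num.sqrt n%:R).
Proof.
move=> phiD Ditv D01 phiL fC n_gt0.
have s_gt0 : 0 < Num.sqrt n%:R :> R by rewrite sqrtr_gt0 ltr0n.
have phiLE x y : 0 <= x <= 1 -> 0 <= y <= 1 -> `|phi y - phi x| <= L * `|y - x|.
  by move=> x01 y01; apply: (phiL (y, x)); rewrite /= !in_itv.
have L_ge0 : 0 <= L.
  have := phiLE 0 1; rewrite !lexx ler01/= subr0 normr1 mulr1 => /(_ isT isT).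
  exact: le_trans.
have d_ge0 : 0 <= L / Num.sqrt n%:R by rewrite divr_ge0// ltW.
have Dphi x : 0 <= x <= 1 -> D (phi x).
  by move=> x01; apply: phiD; rewrite /= in_itv.
have fM : exists M, forall x, D x -> `|f x| <= M.
  (* [f] is bounded on the compact [[0, 1]], by any real strictly above [M]. *)
  have [M [_ /(_ (M + 1))]] := compact_bounded
    (continuous_compact fC (@segment_compact _ 0 1)).
  rewrite ltrDl ltr01 => /(_ isT) fM; exists (M + 1) => x /D01 x01.
  by apply: fM; exists x.
apply: bernstein_error_le => //.
  have D0 : D (phi 0) by apply: Dphi; rewrite lexx ler01.
  apply: (le_trans (normr_ge0 (f (phi 0) - f (phi 0)))).
  by apply: norm_sub_le_modulus; rewrite // subrr normr0.
move=> x y x01 y01; apply: (norm_sub_le_mul_modulus _ f D); rewrite ?mulr_ge0 ?(ltW s_gt0)//;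
  try exact: Dphi.
rewrite (le_trans (phiLE _ _ x01 y01))//.
rewrite le_eqVlt; apply/orP; left; apply/eqP; field.
by rewrite gt_eqF.
Qed.

Lemma lipschitz_continuous_within (R : realType) (phi : R -> R) (L : R)
    (A : set R) :
  L.-lipschitz_A phi -> {within A, continuous phi}.
Proof.
move=> phiL; apply/subspace_continuousP => x Ax.
apply/cvgrPdist_le => e e_gt0; rewrite near_withinE.
(* No sign of [L] is assumed; [|L| + 1] is a Lipschitz constant by which [e] can be divided. *)
have M_gt0 : 0 < `|L| + 1 by rewrite ltr_wpDl.
near=> y => Ay; apply: (le_trans (phiL (x, y) (conj Ax Ay))) => /=.
apply: (@le_trans _ _ ((`|L| + 1) * `|x - y|)).
  by apply: ler_wpM2r => //; rewrite (le_trans (ler_norm L))// lerDl.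
rewrite mulrC -ler_pdivlMr//.
near: y; apply: cvgr_dist_le => //; exact: divr_gt0.
Unshelve. all: by end_near. Qed.

(* The bound is false with the literal interval [phi 0, phi 1] when phi leaves
   it (n = 1, f = id, phi x = x * (1 - x): the error is 1/4, the modulus over
   {0} is 0). The first conjunct reads the interval as the range phi([0,1]), for
   every Lipschitz phi; the second is the literal bound, for every Lipschitz phi
   with values in [phi 0, phi 1], for instance a nondecreasing one. *)
Theorem theorem4p1 (R : realType) (phi : R -> R) (L : R)
    (phi01 : set_fun `[0, 1] `[0, 1] phi)
    (phiL : L.-lipschitz_(`[0, 1]) phi)
    (f : R -> R) (fC : {within `[0, 1], continuous f})
    (n : nat) (n_gt0 : (0 < n)%N) :
  sup_norm01 (bernstein n (koopman phi f) \- koopman phi f)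
    <= 3 / 2 * modulus_of_continuity f (phi @` `[0, 1]) (L / Num.sqrt n%:R)
  /\ (set_fun `[0, 1] `[phi 0, phi 1] phi ->
      sup_norm01 (bernstein n (koopman phi f) \- koopman phi f)
        <= 3 / 2 * modulus_of_continuity f `[phi 0, phi 1]
                     (L / Num.sqrt n%:R)).
Proof.
split=> [|phi_itv]; apply: bernstein_koopman_error_le => //.
(* The range of [phi] is a continuous image of a connected set, hence an interval. *)
- apply/connected_intervalP/connected_continuous_connected.
    by apply/connected_intervalP; exact: interval_is_interval.
  exact: lipschitz_continuous_within phiL.
- by move=> _ [x x01 <-]; exact: phi01.
- exact: interval_is_interval.
- have phi_01 x : x = 0 \/ x = 1 -> 0 <= phi x <= 1.
    move=> x01; have := phi01 x; rewrite /= !in_itv/=; apply.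
    by case: x01 => ->; rewrite ?lexx ?ler01.
  have /andP[phi0_ge0 _] := phi_01 0 (or_introl erefl).
  have /andP[_ phi1_le1] := phi_01 1 (or_intror erefl).
  by move=> x /=; rewrite !in_itv/= => /andP[? ?]; apply/andP; split; lra.
Qed.
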